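(* Let $p>1$. There exists a (nontrivial) entire solution $(U,V)$, $U,V>0$ on $\mathbb R$, of $$(|U'|^{p-2}U')'=V^pU^{p-1},\qquad (|V'|^{p-2}V')'=U^pV^{p-1}\qquad\text{on }\mathbb R,$$ such that $U(x)=V(-x)$ for all $x\in\mathbb R$. *)

(* Defs.v *)
From Stdlib Require Import Reals.
From Coquelicot Require Import Coquelicot.
Open Scope R_scope.

(** The flux |s|^{p-2} s of the one-dimensional p-Laplacian.  At [s = 0] its
    value is [0] for every [p], which is the continuous extension when
    [1 < p < 2] (Stdlib's [Rpower 0 (p - 2)] is the junk value [1], harmless
    here because of the factor [s]). *)
Definition p_flux (p s : R) : R := Rpower (Rabs s) (p - 2) * s.

(** Classical C^1 solutions.  [Rpower a b] is the real power a^b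
    only for [a > 0], so the right-hand side has its intended meaning because
    [U] and [V] are positive. *)
Definition positive_entire_solution (p : R) (U V : R -> R) : Prop :=
  (forall x, 0 < U x) /\
  (forall x, 0 < V x) /\
  (forall x, ex_derive U x /\ continuous (Derive U) x) /\
  (forall x, ex_derive V x /\ continuous (Derive V) x) /\
  (forall x, is_derive (fun t => p_flux p (Derive U t)) x
               (Rpower (V x) p * Rpower (U x) (p - 1))) /\
  (forall x, is_derive (fun t => p_flux p (Derive V t)) x
               (Rpower (U x) p * Rpower (V x) (p - 1))).

(* Main.v *)
Require Import Defs.
From Stdlib Require Import Reals Lra Lia ZArith Classical.
From Coquelicot Require Import Coquelicot.
From mathcomp Require boolp filter.
Open Scope R_scope.

(* By the symmetry [U x = V (- x)] it suffices to find, on [0, +oo), a solution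
   of the first-order system for (U, P, V, R), with [P] the flux of U' and [- R]
   the flux of V', such that [U = V] and [P = R] at 0 and [V], [R] stay
   nonnegative.  Scaling allows the normalization [U = V = t], [P = R = 1 - t] at
   0, with [t] in [0, 1].  Shooting in [t] is done on an Euler scheme: at t = 0,
   [V] is never positive, at t = 1, [R] is never positive, and the two cannot
   fail together, so the intermediate value theorem provides a good [t] for every
   step and every horizon, without any ODE theory.  All components are monotone,
   so their increments are squeezed between explicit slopes; these inequalities
   pass to the pointwise limit along an ultrafilter of step sizes, with no
   equicontinuity argument, and give the differential equations back.  Positivity
   of the limit comes from the absence of dead cores at the exponent [p - 1]. *)

(** * Real powers extended by zero *)

(* Unlike [Rpower], continuous at 0 when [0 < a]. *)
Definition pos_pow (a s : R) : R := if Rlt_dec 0 s then Rpower s a else 0.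

Lemma pos_pow_pos (a s : R) (hs : 0 < s) : pos_pow a s = Rpower s a.
Proof. unfold pos_pow; destruct (Rlt_dec 0 s); [reflexivity | lra]. Qed.

Lemma pos_pow_nonpos (a s : R) (hs : s <= 0) : pos_pow a s = 0.
Proof. unfold pos_pow; destruct (Rlt_dec 0 s); [lra | reflexivity]. Qed.

Lemma pos_pow_ge0 (a s : R) : 0 <= pos_pow a s.
Proof.
unfold pos_pow; destruct (Rlt_dec 0 s); [|lra].
apply Rlt_le, exp_pos.
Qed.

Lemma pos_pow_le (a s t : R) (ha : 0 < a) (hst : s <= t) :
  pos_pow a s <= pos_pow a t.
Proof.
destruct (Rlt_dec 0 s) as [hs | hs].
- rewrite !pos_pow_pos by lra. apply Rle_Rpower_l; lra.
- rewrite (pos_pow_nonpos a s) by lra. apply pos_pow_ge0.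
Qed.

Lemma pos_pow_exp (a x : R) : pos_pow a (exp x) = exp (a * x).
Proof.
rewrite pos_pow_pos by apply exp_pos.
unfold Rpower; now rewrite ln_exp.
Qed.

Lemma pos_pow_1 (a : R) : pos_pow a 1 = 1.
Proof. rewrite <- exp_0, pos_pow_exp; f_equal; ring. Qed.

Lemma pos_pow_K (a b s : R) (hab : a * b = 1) (hs : 0 <= s) :
  pos_pow a (pos_pow b s) = s.
Proof.
destruct (Rlt_dec 0 s) as [h | h].
- rewrite (pos_pow_pos b s) by easy. unfold Rpower.
  rewrite pos_pow_exp, <- Rmult_assoc, hab, Rmult_1_l. now apply exp_ln.
- rewrite (pos_pow_nonpos b s), pos_pow_nonpos; lra.
Qed.

Lemma pos_pow_continuous (a s : R) (ha : 0 < a) : continuous (pos_pow a) s.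
Proof.
destruct (Rlt_dec 0 s) as [hs | hs].
- apply continuous_ext_loc with (fun x => exp (a * ln x)).
  + apply (locally_interval _ s 0 p_infty); simpl; try easy.
    intros y hy _. now rewrite pos_pow_pos.
  + apply continuous_comp with (g := exp).
    * apply (continuous_mult (fun _ => a) ln).
      -- apply continuous_const.
      -- apply continuity_pt_filterlim, derivable_continuous_pt.
         exists (/ s). now apply derivable_pt_lim_ln.
    * apply continuity_pt_filterlim, derivable_continuous_pt, derivable_pt_exp.
(* For [s <= 0] the value is 0, and the radius [eps] to the power [/ a] works: a positive [y] below
   it has [pos_pow a y < eps]. *)
- intros P [eps hP]. rewrite pos_pow_nonpos in hP by lra.
  assert (hd : 0 < pos_pow (/ a) eps).
  { rewrite pos_pow_pos by apply cond_pos. apply exp_pos. }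
  exists (mkposreal _ hd). intros y hy. apply hP.
  assert (hys : Rabs (y - s) < pos_pow (/ a) eps) by apply hy.
  assert (hlt : y < pos_pow (/ a) eps).
  { pose proof (Rle_abs (y - s)). lra. }
  change (Rabs (pos_pow a y - 0) < eps).
  rewrite Rminus_0_r, Rabs_pos_eq by apply pos_pow_ge0.
  destruct (Rlt_dec 0 y) as [hy0 | hy0].
  + rewrite <- (pos_pow_K a (/ a) eps);
      [| field; lra | apply Rlt_le, cond_pos].
    rewrite (pos_pow_pos a y), (pos_pow_pos a (pos_pow (/ a) eps)) by lra.
    apply Rlt_Rpower_l; lra.
  + rewrite pos_pow_nonpos by lra. apply cond_pos.
Qed.

(** * Limits along an ultrafilter *)

(** The ultrafilter lemma of MathComp applied to [eventually]. The work is in translating between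
    the two notions of proper filter: there the empty set is excluded, here every member must be
    inhabited. *)
Lemma ultrafilter_at_infinity :
  exists F : (nat -> Prop) -> Prop,
    ProperFilter F /\ filter_le F eventually /\
    (forall P : nat -> Prop, F P \/ F (fun n => ~ P n)).
Proof.
assert (hev : filter.ProperFilter (T := nat) eventually).
{ split.
  - intros [N hN]. exact (hN N (le_n N)).
  - split.
    + exists 0%nat; easy.
    + intros A B hA hB. exact (filter_and A B hA hB).
    + intros A B hAB hA. exact (filter_imp A B hAB hA). }
destruct (filter.ultraFilterLemma hev) as [F [hF hle]].
exists F. destruct (filter.ultra_proper (F := F)) as [hne [hT hI hS]].
repeat split.
- intros P hP. apply NNPP. intro hno. apply hne.
  apply (hS P); [|easy]. intros n hn. apply hno. now exists n.
- exact hT.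
- intros P Q hP hQ. exact (hI P Q hP hQ).
- intros P Q hPQ hP. exact (hS P Q hPQ hP).
- exact hle.
- intro P. exact (filter.in_ultra_setVsetC P hF).
Qed.

(** The limit is the supremum of the [r] that lie below [f] on a member of [F]. *)
Lemma ultralimit_exists (F : (nat -> Prop) -> Prop) (hF : ProperFilter F)
  (hultra : forall P : nat -> Prop, F P \/ F (fun n => ~ P n))
  (f : nat -> R) (m M : R) (hf : F (fun n => m <= f n <= M)) :
  exists l : R, filterlim f F (locally l).
Proof.
set (E := fun r => F (fun n => r <= f n)).
destruct (completeness E) as [l [hub hlub]].
- exists M. intros r hr.
  destruct (filter_ex _ (filter_and _ _ hf hr)) as [n hn]. lra.
- exists m. apply filter_imp with (2 := hf). intros; lra.
- exists l. intros P [eps hP]. pose proof (cond_pos eps) as heps.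
  assert (hlow : exists r, E r /\ l - eps < r).
  { apply NNPP. intro hno.
    assert (l <= l - eps); [|lra].
    apply hlub. intros r hr. apply Rnot_lt_le. intro hlt.
    apply hno. now exists r. }
  destruct hlow as [r [hr hlr]].
  (* If this set were in [F], then [l + eps / 2] would belong to [E], above its supremum. Hence its
     complement is in [F], which bounds [f] from above. *)
  destruct (hultra (fun n => l + eps / 2 <= f n)) as [h | h].
  + specialize (hub _ h). lra.
  + apply (filter_imp _ _) with (2 := filter_and _ _ hr h).
    intros n [h1 h2]. apply hP. apply Rabs_def1; simpl.
    all: unfold minus, plus, opp; simpl; lra.
Qed.

(** * Shooting for the Euler scheme *)

Record state := State { sU : R; sP : R; sV : R; sR : R }.

(* Semi-implicit in the last component: once [sV] is nonpositive, [sR] no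
   longer moves, so [sV] and [sR] cannot both become nonpositive. *)
Definition euler_step (p h : R) (s : state) : state :=
  let v := sV s - h * pos_pow (/ (p - 1)) (sR s) in
  State (sU s + h * pos_pow (/ (p - 1)) (sP s))
        (sP s + h * (pos_pow p (sV s) * pos_pow (p - 1) (sU s)))
        v
        (sR s - h * (pos_pow p (sU s) * pos_pow (p - 1) v)).

Fixpoint euler (p h t : R) (n : nat) : state :=
  match n with
  | O => State t (1 - t) t (1 - t)
  | S m => euler_step p h (euler p h t m)
  end.

Lemma euler_continuous (p h : R) (n : nat) (hp : 1 < p) (t : R) :
  continuous (fun t => sU (euler p h t n)) t /\
  continuous (fun t => sP (euler p h t n)) t /\
  continuous (fun t => sV (euler p h t n)) t /\
  continuous (fun t => sR (euler p h t n)) t.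
Proof.
assert (hq : 0 < / (p - 1)) by (apply Rinv_0_lt_compat; lra).
assert (hpow : forall a f, 0 < a -> continuous f t ->
  continuous (fun t => pos_pow a (f t)) t).
{ intros a f ha hf. apply (continuous_comp f (pos_pow a)); [easy|].
  now apply pos_pow_continuous. }
assert (hmul : forall f g : R -> R, continuous f t -> continuous g t ->
  continuous (fun t => f t * g t) t).
{ intros f g hf hg. now apply (continuous_mult f g). }
assert (hadd : forall f g : R -> R, continuous f t -> continuous g t ->
  continuous (fun t => f t + g t) t).
{ intros f g hf hg. now apply (continuous_plus f g). }
assert (hsub : forall f g : R -> R, continuous f t -> continuous g t ->
  continuous (fun t => f t - g t) t).
{ intros f g hf hg. now apply (continuous_minus f g). }
assert (hcst : forall c : R, continuous (fun _ : R => c) t).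
{ intro c. apply continuous_const. }
induction n as [|n [hU [hP [hV hR]]]]; simpl.
- pose proof (continuous_id t). repeat split; auto.
- repeat split; auto 10 with real.
  + apply hadd; auto. apply hmul; auto. apply hmul; apply hpow; auto; lra.
  + apply hsub; auto. apply hmul; auto. apply hmul; apply hpow; auto; lra.
Qed.

(** Initially the two components add up to 1. In one step, [sV] stands still if the old [sR] is
    nonpositive, and [sR] stands still if the new [sV] is nonpositive. *)
Lemma euler_alternative (p h t : R) (n : nat) :
  0 < sV (euler p h t n) \/ 0 < sR (euler p h t n).
Proof.
induction n as [|n IH]; simpl; [lra|].
set (s := euler p h t n) in *.
destruct (Rlt_dec 0 (sR s)) as [hR | hR].
- destruct (Rlt_dec 0 (sV s - h * pos_pow (/ (p - 1)) (sR s))); [now left|].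
  right. rewrite (pos_pow_nonpos (p - 1)); lra.
- left. rewrite pos_pow_nonpos; lra.
Qed.

Lemma telescoping_bounds (f : nat -> R) (a b : R) (n m : nat)
  (hnm : (n <= m)%nat)
  (hf : forall i, (n <= i < m)%nat -> a <= f (S i) - f i <= b) :
  (INR m - INR n) * a <= f m - f n <= (INR m - INR n) * b.
Proof.
induction hnm as [|m hnm IH]; [lra|].
rewrite S_INR.
assert (h : a <= f (S m) - f m <= b) by (apply hf; lia).
assert (h' : (INR m - INR n) * a <= f m - f n <= (INR m - INR n) * b).
{ apply IH. intros i hi. apply hf. lia. }
lra.
Qed.

Lemma euler_monotone (p h t : R) (hh : 0 < h) (n m : nat) (hnm : (n <= m)%nat) :
  sU (euler p h t n) <= sU (euler p h t m) /\
  sP (euler p h t n) <= sP (euler p h t m) /\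
  sV (euler p h t m) <= sV (euler p h t n) /\
  sR (euler p h t m) <= sR (euler p h t n).
Proof.
assert (hpow : forall a b s u, 0 <= h * (pos_pow a s * pos_pow b u)).
{ intros. apply Rmult_le_pos; [lra|].
  apply Rmult_le_pos; apply pos_pow_ge0. }
induction hnm as [|m hnm IH]; [lra|].
simpl. set (s := euler p h t m) in *.
pose proof (Rmult_le_pos _ _ (Rlt_le _ _ hh) (pos_pow_ge0 (/ (p - 1)) (sP s))).
pose proof (Rmult_le_pos _ _ (Rlt_le _ _ hh) (pos_pow_ge0 (/ (p - 1)) (sR s))).
pose proof (hpow p (p - 1) (sV s) (sU s)).
pose proof (hpow p (p - 1) (sU s)
  (sV s - h * pos_pow (/ (p - 1)) (sR s))).
lra.
Qed.

Lemma euler_shooting (p h : R) (N : nat) (hp : 1 < p) (hh : 0 < h) :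
  exists t, 0 <= t <= 1 /\
    (forall n, (n <= N)%nat ->
       0 < sV (euler p h t n) /\ 0 < sR (euler p h t n)).
Proof.
(* [pos_pow 1] is the positive part. At a zero of [g] the positive parts of [sV] and [sR] at the
   horizon agree, and since they cannot both be 0, both are positive. *)
set (g := fun t => pos_pow 1 (sV (euler p h t N)) - pos_pow 1 (sR (euler p h t N))).
assert (hid : forall x, 0 < x -> pos_pow 1 x = x).
{ intros x hx. rewrite pos_pow_pos by easy. now apply Rpower_1. }
assert (hg : continuity g).
{ intro t. apply continuity_pt_filterlim.
  destruct (euler_continuous p h N hp t) as [_ [_ [hV hR]]].
  apply (continuous_minus (fun t => pos_pow 1 (sV (euler p h t N)))
           (fun t => pos_pow 1 (sR (euler p h t N)))).
  - apply (continuous_comp _ (pos_pow 1)); [easy|].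
    apply pos_pow_continuous; lra.
  - apply (continuous_comp _ (pos_pow 1)); [easy|].
    apply pos_pow_continuous; lra. }
assert (h0 : g 0 <= 0).
{ destruct (euler_monotone p h 0 hh 0 N) as [_ [_ [hV _]]]; [lia|].
  simpl in hV. unfold g. rewrite pos_pow_nonpos by easy.
  pose proof (pos_pow_ge0 1 (sR (euler p h 0 N))). lra. }
assert (h1 : 0 <= g 1).
{ destruct (euler_monotone p h 1 hh 0 N) as [_ [_ [_ hR]]]; [lia|].
  simpl in hR. unfold g. rewrite (pos_pow_nonpos 1 (sR _)) by lra.
  pose proof (pos_pow_ge0 1 (sV (euler p h 1 N))). lra. }
destruct (IVT_gen g 0 1 0 hg) as [t [ht hgt]].
{ split; [apply Rle_trans with (1 := Rmin_l _ _)
         | apply Rle_trans with (2 := Rmax_r _ _)]; easy. }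
rewrite Rmin_left, Rmax_right in ht by lra.
exists t. split; [easy|].
assert (hN : 0 < sV (euler p h t N) /\ 0 < sR (euler p h t N)).
{ unfold g in hgt.
  destruct (euler_alternative p h t N) as [h' | h'].
  - split; [easy|]. apply Rnot_le_lt. intro hle.
    rewrite hid, (pos_pow_nonpos 1 (sR _)) in hgt; lra.
  - split; [|easy]. apply Rnot_le_lt. intro hle.
    rewrite (pos_pow_nonpos 1 (sV _)), hid in hgt; lra. }
(* Both components are nonincreasing in [n], so positivity at the horizon gives it at all earlier
   steps. *)
intros n hn. destruct (euler_monotone p h t hh n N hn). lra.
Qed.

(** Bounds uniform in the step size, needed for limits to exist. Since [sV] stays at most 1, the two
    exponentials reproduce each other: the power [/ (p - 1)] of the bound for [sP] is the bound for
    [sU], and the power [p - 1] leads back. *)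
Lemma euler_growth (p h t : R) (n : nat) (hp : 1 < p) (hh : 0 < h)
  (ht : 0 <= t <= 1) :
  sU (euler p h t n) <= exp (p / (p - 1) * (INR n * h)) /\
  sP (euler p h t n) <= exp (p * (INR n * h)).
Proof.
assert (hq : 0 < / (p - 1)) by (apply Rinv_0_lt_compat; lra).
assert (hK : p / (p - 1) = 1 + / (p - 1)) by (field; lra).
induction n as [|n [hU hP]].
- simpl. rewrite !Rmult_0_l, !Rmult_0_r, exp_0. lra.
- simpl euler. simpl sU; simpl sP. rewrite S_INR.
  destruct (euler_monotone p h t hh 0 n) as [_ [_ [hV _]]]; [lia|].
  simpl in hV. set (s := euler p h t n) in *.
  assert (hPq : pos_pow (/ (p - 1)) (sP s) <= exp (p / (p - 1) * (INR n * h))).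
  { apply Rle_trans with (1 := pos_pow_le _ _ _ hq hP).
    rewrite pos_pow_exp. right. f_equal. field. lra. }
  assert (hVp : pos_pow p (sV s) <= 1).
  { rewrite <- (pos_pow_1 p). apply pos_pow_le; lra. }
  assert (hUp : pos_pow (p - 1) (sU s) <= exp (p * (INR n * h))).
  { apply Rle_trans with (pos_pow (p - 1) (exp (p / (p - 1) * (INR n * h)))).
    - apply pos_pow_le; lra.
    - rewrite pos_pow_exp. right. f_equal. field. lra. }
  assert (hVU : pos_pow p (sV s) * pos_pow (p - 1) (sU s)
                <= 1 * exp (p * (INR n * h))).
  { apply Rmult_le_compat; auto using pos_pow_ge0. }
  (* One step multiplies the bound by at most [1 + h <= 1 + c * h <= exp (c * h)]. Both rates, [p]
     and [p / (p - 1)], are at least 1. *)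
  assert (hstep : forall c x y, 1 <= c -> x <= exp (c * (INR n * h)) ->
    y <= exp (c * (INR n * h)) -> x + h * y <= exp (c * ((INR n + 1) * h))).
  { intros c x y hc hx hy.
    replace (c * ((INR n + 1) * h)) with (c * (INR n * h) + c * h) by ring.
    rewrite exp_plus.
    apply Rle_trans with (exp (c * (INR n * h)) * (1 + h)).
    - pose proof (Rmult_le_compat_l h _ _ (Rlt_le _ _ hh) hy). lra.
    - apply Rmult_le_compat_l; [apply Rlt_le, exp_pos|].
      pose proof (exp_ineq1_le (c * h)).
      pose proof (Rmult_le_compat_r h _ _ (Rlt_le _ _ hh) hc). lra. }
  split; apply hstep; lra.
Qed.

(** Each one-step slope is a monotone expression in monotone components, so between steps [n] and
    [m] it lies between values built from the two end states. Summing gives inequalities in which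
    the step size appears only through the elapsed length [d]. *)
Lemma euler_increments (p h t : R) (n m : nat) (hp : 1 < p) (hh : 0 < h)
  (hnm : (n <= m)%nat) :
  let s := euler p h t n in
  let s' := euler p h t m in
  let d := INR m * h - INR n * h in
  (d * pos_pow (/ (p - 1)) (sP s) <= sU s' - sU s
   <= d * pos_pow (/ (p - 1)) (sP s')) /\
  (d * (pos_pow p (sV s') * pos_pow (p - 1) (sU s)) <= sP s' - sP s
   <= d * (pos_pow p (sV s) * pos_pow (p - 1) (sU s'))) /\
  (d * pos_pow (/ (p - 1)) (sR s') <= sV s - sV s'
   <= d * pos_pow (/ (p - 1)) (sR s)) /\
  (d * (pos_pow p (sU s) * pos_pow (p - 1) (sV s')) <= sR s - sR s'
   <= d * (pos_pow p (sU s') * pos_pow (p - 1) (sV s))).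
Proof.
intros s s' d.
assert (hq : 0 < / (p - 1)) by (apply Rinv_0_lt_compat; lra).
pose proof (euler_monotone p h t hh) as hmono.
assert (hprod : forall x x' y y', x <= x' -> y <= y' ->
  h * (pos_pow p x * pos_pow (p - 1) y) <= h * (pos_pow p x' * pos_pow (p - 1) y')).
{ intros. apply Rmult_le_compat_l; [lra|].
  apply Rmult_le_compat; try apply pos_pow_ge0; apply pos_pow_le; lra. }
assert (hpow : forall x x', x <= x' ->
  h * pos_pow (/ (p - 1)) x <= h * pos_pow (/ (p - 1)) x').
{ intros. apply Rmult_le_compat_l; [lra|]. now apply pos_pow_le. }
replace d with ((INR m - INR n) * h) by (unfold d; ring).
rewrite !(Rmult_assoc (INR m - INR n)).
split; [|split; [|split]].
- apply (telescoping_bounds (fun i => sU (euler p h t i))); [easy|].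
  intros i hi. simpl.
  destruct (hmono n i) as [_ [hn _]]; [lia|].
  destruct (hmono i m) as [_ [hm _]]; [lia|].
  pose proof (hpow _ _ hn). pose proof (hpow _ _ hm).
  unfold s, s'. lra.
- apply (telescoping_bounds (fun i => sP (euler p h t i))); [easy|].
  intros i hi. simpl.
  destruct (hmono n i) as [hn [_ [hn' _]]]; [lia|].
  destruct (hmono i m) as [hm [_ [hm' _]]]; [lia|].
  pose proof (hprod _ _ _ _ hm' hn). pose proof (hprod _ _ _ _ hn' hm).
  unfold s, s'. lra.
- assert (H := telescoping_bounds (fun i => - sV (euler p h t i))
    (h * pos_pow (/ (p - 1)) (sR s')) (h * pos_pow (/ (p - 1)) (sR s)) n m hnm).
  cut (forall i, (n <= i < m)%nat ->
    h * pos_pow (/ (p - 1)) (sR s') <=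
      - sV (euler p h t (S i)) - - sV (euler p h t i)
      <= h * pos_pow (/ (p - 1)) (sR s)).
  { intro hi. specialize (H hi). simpl in H. fold s s' in H. lra. }
  intros i hi. simpl.
  destruct (hmono n i) as [_ [_ [_ hn]]]; [lia|].
  destruct (hmono i m) as [_ [_ [_ hm]]]; [lia|].
  pose proof (hpow _ _ hn). pose proof (hpow _ _ hm).
  unfold s, s'. lra.
- assert (H := telescoping_bounds (fun i => - sR (euler p h t i))
    (h * (pos_pow p (sU s) * pos_pow (p - 1) (sV s')))
    (h * (pos_pow p (sU s') * pos_pow (p - 1) (sV s))) n m hnm).
  cut (forall i, (n <= i < m)%nat ->
    h * (pos_pow p (sU s) * pos_pow (p - 1) (sV s')) <=
      - sR (euler p h t (S i)) - - sR (euler p h t i)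
      <= h * (pos_pow p (sU s') * pos_pow (p - 1) (sV s))).
  { intro hi. specialize (H hi). simpl in H. fold s s' in H. lra. }
  (* The slope of [sR] at step [i] uses the new [sV], hence the comparisons at [S i], which is still
     at most [m]. *)
  intros i hi.
  destruct (hmono n i) as [hn _]; [lia|].
  destruct (hmono i m) as [hm _]; [lia|].
  destruct (hmono n (S i)) as [_ [_ [hn' _]]]; [lia|].
  destruct (hmono (S i) m) as [_ [_ [hm' _]]]; [lia|].
  pose proof (hprod _ _ _ _ hn hm'). pose proof (hprod _ _ _ _ hm hn').
  unfold s, s'. simpl in *. lra.
Qed.

(** * Vanishing step size *)

(** The step size is [/ INR (S k)]; for [0 <= x] this is the last grid point not beyond [x].
    Negative arguments are sent to 0. *)
Definition grid_index (k : nat) (x : R) : nat := Z.to_nat (Int_part (x * INR (S k))).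

Lemma grid_index_bounds (k : nat) (x : R) (hx : 0 <= x) :
  x - / INR (S k) <= INR (grid_index k x) * / INR (S k) <= x.
Proof.
pose proof (lt_0_INR (S k) (Nat.lt_0_succ k)) as hk.
assert (hi : 0 < / INR (S k)) by now apply Rinv_0_lt_compat.
destruct (base_Int_part (x * INR (S k))) as [h1 h2].
assert (hz : (0 <= Int_part (x * INR (S k)))%Z).
{ pose proof (Rmult_le_pos _ _ hx (Rlt_le _ _ hk)).
  assert (-1 < Int_part (x * INR (S k)))%Z; [|lia].
  apply lt_IZR. lra. }
unfold grid_index. rewrite (INR_IZR_INZ (Z.to_nat _)), Z2Nat.id by easy.
assert (hxk : x * INR (S k) * / INR (S k) = x) by (field; lra).
split.
- apply Rle_trans with ((x * INR (S k) - 1) * / INR (S k)); [lra|].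
  apply Rmult_le_compat_r; lra.
- rewrite <- hxk at 2. apply Rmult_le_compat_r; lra.
Qed.

Lemma grid_index_0 (k : nat) : grid_index k 0 = 0%nat.
Proof. unfold grid_index. rewrite Rmult_0_l; exact (f_equal Z.to_nat (Int_part_INR 0)). Qed.

Lemma grid_index_le (k : nat) (x y : R) (hxy : x <= y) :
  (grid_index k x <= grid_index k y)%nat.
Proof.
assert (hk : 0 <= INR (S k)) by apply pos_INR.
pose proof (Rmult_le_compat_r _ _ _ hk hxy).
destruct (base_Int_part (x * INR (S k))), (base_Int_part (y * INR (S k))).
assert (Int_part (x * INR (S k)) < Int_part (y * INR (S k)) + 1)%Z;
  [|unfold grid_index; lia].
apply lt_IZR. rewrite plus_IZR. lra.
Qed.

(** With [S k * S k] steps of size [/ INR (S k)] the shooting horizon is [S k], which eventually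
    passes any given [x]. *)
Lemma grid_index_le_square (x : R) (hx : 0 <= x) :
  eventually (fun k => (grid_index k x <= S k * S k)%nat).
Proof.
destruct (nfloor_ex x hx) as [N [_ hN]].
exists N. intros k hk. apply INR_le.
pose proof (lt_0_INR (S k) (Nat.lt_0_succ k)) as hpos.
destruct (grid_index_bounds k x hx) as [_ h].
apply (Rmult_le_compat_r (INR (S k))) in h; [|lra].
rewrite Rmult_assoc, Rinv_l, Rmult_1_r in h by lra.
apply Rle_trans with (1 := h). rewrite mult_INR.
apply Rmult_le_compat_r; [lra|].
apply le_INR in hk. rewrite S_INR. lra.
Qed.

Lemma grid_point_limit (x : R) (hx : 0 <= x) :
  filterlim (fun k => INR (grid_index k x) * / INR (S k)) eventually (locally x).
Proof.
intros P [eps hP].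
destruct (archimed_cor1 eps (cond_pos eps)) as [N [hN hN0]].
exists N. intros k hk. apply hP.
destruct (grid_index_bounds k x hx).
assert (/ INR (S k) <= / INR N).
{ apply Rinv_le_contravar; [now apply lt_0_INR | apply le_INR; lia]. }
assert (0 < / INR N) by (apply Rinv_0_lt_compat, lt_0_INR; easy).
change (Rabs (INR (grid_index k x) * / INR (S k) - x) < eps).
apply Rabs_def1; lra.
Qed.

Lemma limit_le (T : Type) (F : (T -> Prop) -> Prop) (hF : ProperFilter F)
  (f g : T -> R) (a b : R) (hfg : F (fun k => f k <= g k))
  (hf : filterlim f F (locally a)) (hg : filterlim g F (locally b)) : a <= b.
Proof. exact (filterlim_le f g (Finite a) (Finite b) hfg hf hg). Qed.

Lemma limit_mult (T : Type) (F : (T -> Prop) -> Prop) (hF : Filter F)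
  (f g : T -> R) (a b : R)
  (hf : filterlim f F (locally a)) (hg : filterlim g F (locally b)) :
  filterlim (fun k => f k * g k) F (locally (a * b)).
Proof.
exact (filterlim_comp_2 f g Rmult hf hg (filterlim_mult (K := R_AbsRing) a b)).
Qed.

Lemma limit_minus (T : Type) (F : (T -> Prop) -> Prop) (hF : Filter F)
  (f g : T -> R) (a b : R)
  (hf : filterlim f F (locally a)) (hg : filterlim g F (locally b)) :
  filterlim (fun k => f k - g k) F (locally (a - b)).
Proof.
apply (filterlim_comp_2 f (fun k => - g k) Rplus hf
  (filterlim_comp _ _ _ _ _ _ _ _ hg (filterlim_opp (V := R_NormedModule) b))).
exact (filterlim_plus (V := R_NormedModule) a (- b)).
Qed.

Lemma limit_pos_pow (T : Type) (F : (T -> Prop) -> Prop)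
  (f : T -> R) (c a : R) (hc : 0 < c) (hf : filterlim f F (locally a)) :
  filterlim (fun k => pos_pow c (f k)) F (locally (pos_pow c a)).
Proof.
exact (filterlim_comp _ _ _ _ _ _ _ _ hf (pos_pow_continuous c a hc)).
Qed.

(** The squeezed increments are closed conditions on the values at two points, so they survive a
    merely pointwise limit; they encode the first-order system without mentioning derivatives. *)
Lemma half_line_profile (p : R) (hp : 1 < p) :
  exists s : R -> state,
    (forall x, 0 <= x -> 0 <= sU (s x) /\ 0 <= sP (s x) /\
                         0 <= sV (s x) /\ 0 <= sR (s x)) /\
    sU (s 0) = sV (s 0) /\ sP (s 0) = sR (s 0) /\ sU (s 0) + sP (s 0) = 1 /\
    (forall x y, 0 <= x <= y ->
      ((y - x) * pos_pow (/ (p - 1)) (sP (s x)) <= sU (s y) - sU (s x)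
       <= (y - x) * pos_pow (/ (p - 1)) (sP (s y))) /\
      ((y - x) * (pos_pow p (sV (s y)) * pos_pow (p - 1) (sU (s x)))
         <= sP (s y) - sP (s x)
       <= (y - x) * (pos_pow p (sV (s x)) * pos_pow (p - 1) (sU (s y)))) /\
      ((y - x) * pos_pow (/ (p - 1)) (sR (s y)) <= sV (s x) - sV (s y)
       <= (y - x) * pos_pow (/ (p - 1)) (sR (s x))) /\
      ((y - x) * (pos_pow p (sU (s x)) * pos_pow (p - 1) (sV (s y)))
         <= sR (s x) - sR (s y)
       <= (y - x) * (pos_pow p (sU (s y)) * pos_pow (p - 1) (sV (s x))))).
Proof.
assert (hq : 0 < / (p - 1)) by (apply Rinv_0_lt_compat; lra).
assert (hK : 0 < p / (p - 1)) by (apply Rdiv_lt_0_compat; lra).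
destruct ultrafilter_at_infinity as [F [hF [hle hultra]]].
assert (hstep : forall k, 0 < / INR (S k)).
{ intro k. apply Rinv_0_lt_compat, lt_0_INR. lia. }
(* One shooting parameter [t k] is chosen for each step size, good up to the horizon [S k]. *)
destruct (boolp.choice (fun k =>
  euler_shooting p (/ INR (S k)) (S k * S k) hp (hstep k))) as [t ht].
set (e := fun k x => euler p (/ INR (S k)) (t k) (grid_index k x)).
assert (hpos : forall x, 0 <= x -> F (fun k =>
  (0 <= sU (e k x) <= exp (p / (p - 1) * x)) /\ (0 <= sP (e k x) <= exp (p * x)) /\
  (0 <= sV (e k x) <= 1) /\ (0 <= sR (e k x) <= 1))).
{ intros x hx. apply hle.
  apply (filter_imp _ _) with (2 := grid_index_le_square x hx). intros k hk.
  destruct (ht k) as [htk hVR].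
  destruct (hVR _ hk) as [hV hR].
  destruct (euler_monotone p (/ INR (S k)) (t k) (hstep k) 0 (grid_index k x))
    as [mU [mP [mV mR]]]; [lia|].
  destruct (euler_growth p (/ INR (S k)) (t k) (grid_index k x) hp (hstep k) htk)
    as [gU gP].
  destruct (grid_index_bounds k x hx) as [_ hgx].
  fold (e k x) in mU, mP, mV, mR, gU, gP, hV, hR.
  simpl (euler _ _ _ 0) in mU, mP, mV, mR. simpl in mU, mP, mV, mR.
  assert (hexp : forall c, 0 < c ->
    exp (c * (INR (grid_index k x) * / INR (S k))) <= exp (c * x)).
  { intros c hc. apply (Rmult_le_compat_l c) in hgx; [|lra].
    destruct hgx as [hlt | heq]; [left; now apply exp_increasing|].
    rewrite heq. apply Rle_refl. }
  pose proof (hexp _ hK). pose proof (hexp p ltac:(lra)).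
  repeat split; lra. }
assert (hlim : forall x, exists l : state, 0 <= x ->
  filterlim (fun k => sU (e k x)) F (locally (sU l)) /\
  filterlim (fun k => sP (e k x)) F (locally (sP l)) /\
  filterlim (fun k => sV (e k x)) F (locally (sV l)) /\
  filterlim (fun k => sR (e k x)) F (locally (sR l))).
{ intro x. destruct (Rle_dec 0 x) as [hx | hx].
  - assert (hb : forall f : state -> R,
      (exists m M, F (fun k => m <= f (e k x) <= M)) ->
      exists l, filterlim (fun k => f (e k x)) F (locally l)).
    { intros f [m [M h]]. exact (ultralimit_exists F hF hultra _ m M h). }
    destruct (hb sU) as [lU hU].
    { exists 0, (exp (p / (p - 1) * x)).
      apply (filter_imp _ _) with (2 := hpos x hx). tauto. }
    destruct (hb sP) as [lP hP].
    { exists 0, (exp (p * x)).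
      apply (filter_imp _ _) with (2 := hpos x hx). tauto. }
    destruct (hb sV) as [lV hV].
    { exists 0, 1. apply (filter_imp _ _) with (2 := hpos x hx). tauto. }
    destruct (hb sR) as [lR hR].
    { exists 0, 1. apply (filter_imp _ _) with (2 := hpos x hx). tauto. }
    exists (State lU lP lV lR). now simpl.
  - exists (State 0 0 0 0). easy. }
destruct (boolp.choice hlim) as [s hs].
assert (hge0 : forall (f : nat -> R) a, F (fun k => 0 <= f k) ->
  filterlim f F (locally a) -> 0 <= a).
{ intros f a hf ha.
  apply (limit_le nat F hF (fun _ => 0) f); auto. apply filterlim_const. }
exists s. split; [|split; [|split; [|split]]].
- intros x hx. destruct (hs x hx) as [hU [hP [hV hR]]].
  split; [|split; [|split]].
  + apply hge0 with (2 := hU).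
    apply (filter_imp _ _) with (2 := hpos x hx). tauto.
  + apply hge0 with (2 := hP).
    apply (filter_imp _ _) with (2 := hpos x hx). tauto.
  + apply hge0 with (2 := hV).
    apply (filter_imp _ _) with (2 := hpos x hx). tauto.
  + apply hge0 with (2 := hR).
    apply (filter_imp _ _) with (2 := hpos x hx). tauto.
- destruct (hs 0 (Rle_refl 0)) as [hU [_ [hV _]]].
  apply (filterlim_locally_unique (V := R_NormedModule)) with (1 := hU).
  apply filterlim_ext with (2 := hV).
  intro k. unfold e. now rewrite grid_index_0.
- destruct (hs 0 (Rle_refl 0)) as [_ [hP [_ hR]]].
  apply (filterlim_locally_unique (V := R_NormedModule)) with (1 := hP).
  apply filterlim_ext with (2 := hR).
  intro k. unfold e. now rewrite grid_index_0.
- destruct (hs 0 (Rle_refl 0)) as [hU [hP _]].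
  enough (sP (s 0) = 1 - sU (s 0)) by lra.
  apply (filterlim_locally_unique (V := R_NormedModule)) with (1 := hP).
  apply filterlim_ext with (fun k => 1 - sU (e k 0)).
  + intro k. unfold e. now rewrite grid_index_0.
  + apply limit_minus; [apply hF | apply filterlim_const | exact hU].
- intros x y [hx hxy].
  destruct (hs x hx) as [hUx [hPx [hVx hRx]]].
  assert (hy : 0 <= y) by lra.
  destruct (hs y hy) as [hUy [hPy [hVy hRy]]].
  assert (hF' : Filter F) by apply hF.
  assert (hd : filterlim (fun k => INR (grid_index k y) * / INR (S k) -
      INR (grid_index k x) * / INR (S k)) F (locally (y - x))).
  { apply (filterlim_filter_le_1 _ hle).
    apply limit_minus; [apply eventually_filter | |]; now apply grid_point_limit. }
  assert (hinc := fun k => euler_increments p (/ INR (S k)) (t k) _ _ hp (hstep k)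
    (grid_index_le k x y hxy)).
  cbv zeta in hinc.
  assert (hall : forall P : nat -> Prop, (forall k, P k) -> F P).
  { intros P hP. apply (filter_imp (fun _ => True)); [easy | apply filter_true]. }
  (* The sequences on both sides are left open and read off from the shape of their limits; only
     then is the shelved inequality between them an instance of [hinc]. *)
  repeat split; (eapply (limit_le nat F hF); [shelve | |]);
    repeat match goal with
    | |- 0 < _ => lra
    | |- filterlim _ _ (locally (y - x)) => exact hd
    | |- filterlim _ _ (locally (_ * _)) => apply limit_mult
    | |- filterlim _ _ (locally (_ - _)) => apply limit_minus
    | |- filterlim _ _ (locally (pos_pow _ _)) => apply limit_pos_pow
    | |- _ => eassumption
    end.
  Unshelve.
  all: apply hall; intro k; destruct (hinc k) as [[] [[] [[] []]]]; assumption.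
Qed.

(** * Differential equations and positivity *)

(** With one endpoint fixed at [x] and the other tending to it, both bounds on the difference
    quotient tend to [G x x]. Two arguments are used because the slope of [Q] combines values of [A]
    at reflected points, which vary in opposite directions. *)
Lemma is_derive_of_two_sided_slopes (f : R -> R) (G : R -> R -> R) (x : R)
  (hf : forall a b, a <= b -> (b - a) * G a b <= f b - f a <= (b - a) * G b a)
  (hG1 : continuous (fun y => G x y) x) (hG2 : continuous (fun y => G y x) x) :
  is_derive f x (G x x).
Proof.
apply is_derive_Reals. intros eps heps.
assert (hnear : locally x (fun y =>
  Rabs (G x y - G x x) < eps /\ Rabs (G y x - G x x) < eps)).
{ apply filter_and.
  - apply (hG1 (fun z => Rabs (z - G x x) < eps)). now exists (mkposreal eps heps).
  - apply (hG2 (fun z => Rabs (z - G x x) < eps)). now exists (mkposreal eps heps). }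
destruct hnear as [delta hdelta]. exists delta. intros h h0 hh.
destruct (hdelta (x + h)) as [h1 h2].
{ change (Rabs (x + h - x) < delta). now replace (x + h - x) with h by ring. }
apply Rabs_def2 in h1. apply Rabs_def2 in h2.
set (q := (f (x + h) - f x) / h).
assert (hq : f (x + h) - f x = h * q) by (unfold q; now field).
apply Rabs_def1.
- destruct (Rdichotomy _ _ h0) as [hneg | hpos].
  + destruct (hf (x + h) x) as [_ H]; [lra|].
    assert (q <= G x (x + h)); [|lra].
    apply Rmult_le_reg_l with (- h); lra.
  + destruct (hf x (x + h)) as [_ H]; [lra|].
    assert (q <= G (x + h) x); [|lra].
    apply Rmult_le_reg_l with h; lra.
- destruct (Rdichotomy _ _ h0) as [hneg | hpos].
  + destruct (hf (x + h) x) as [H _]; [lra|].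
    assert (G (x + h) x <= q); [|lra].
    apply Rmult_le_reg_l with (- h); lra.
  + destruct (hf x (x + h)) as [H _]; [lra|].
    assert (G x (x + h) <= q); [|lra].
    apply Rmult_le_reg_l with h; lra.
Qed.

(** A local Lipschitz bound. It yields continuity of [Q] before anything is known about
    derivatives. *)
Lemma continuous_of_local_slopes (f : R -> R) (x M : R)
  (hf : forall a b, x - 1 <= a <= b -> b <= x + 1 ->
          0 <= f b - f a <= (b - a) * M) :
  continuous f x.
Proof.
intros P [eps hP]. pose proof (cond_pos eps).
assert (hM : 0 < Rabs M + 1) by (pose proof (Rabs_pos M); lra).
assert (hd : 0 < Rmin 1 (eps / (Rabs M + 1))).
{ apply Rmin_glb_lt; [lra | now apply Rdiv_lt_0_compat]. }
exists (mkposreal _ hd). intros y hy. apply hP.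
assert (hy1 : Rabs (y - x) < 1).
{ apply Rlt_le_trans with (1 := hy). apply Rmin_l. }
assert (hy2 : Rabs (y - x) * (Rabs M + 1) < eps).
{ apply Rlt_le_trans with (eps / (Rabs M + 1) * (Rabs M + 1)).
  - apply Rmult_lt_compat_r; [easy|].
    apply Rlt_le_trans with (1 := hy). apply Rmin_r.
  - right. field. lra. }
change (Rabs (f y - f x) < eps).
apply Rle_lt_trans with (2 := hy2).
pose proof (Rle_abs M).
destruct (Rle_dec x y) as [hxy | hxy].
- rewrite (Rabs_pos_eq (y - x)) in * by lra.
  destruct (hf x y); [lra | lra|].
  rewrite Rabs_pos_eq by lra.
  apply Rle_trans with ((y - x) * M); [lra|].
  apply Rmult_le_compat_l; lra.
- rewrite (Rabs_left (y - x)) in * by lra.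
  destruct (hf y x); [lra | lra|].
  rewrite Rabs_left1 by lra.
  apply Rle_trans with ((x - y) * M); [lra|].
  replace (- (y - x)) with (x - y) by ring.
  apply Rmult_le_compat_l; lra.
Qed.

(** [A] is U on the right and the reflection of V on the left; [Q], the flux of [A'], is P on the
    right and the reflection of R on the left. With V replaced by the reflection of [A], the system
    becomes two nonlocal equations for the nondecreasing pair [A], [Q]. *)
Lemma line_profile (p : R) (hp : 1 < p) :
  exists A Q : R -> R,
    (forall x, 0 <= A x) /\ (forall x, 0 <= Q x) /\ A 0 + Q 0 = 1 /\
    (forall x y, x <= y ->
      (y - x) * pos_pow (/ (p - 1)) (Q x) <= A y - A x
      <= (y - x) * pos_pow (/ (p - 1)) (Q y)) /\
    (forall x y, x <= y ->
      (y - x) * (pos_pow p (A (- y)) * pos_pow (p - 1) (A x)) <= Q y - Q x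
      <= (y - x) * (pos_pow p (A (- x)) * pos_pow (p - 1) (A y))).
Proof.
assert (hq : 0 < / (p - 1)) by (apply Rinv_0_lt_compat; lra).
destruct (half_line_profile p hp) as [s [hs [h0A [h0Q [h01 hinc]]]]].
set (A := fun x => if Rle_dec 0 x then sU (s x) else sV (s (- x))).
set (Q := fun x => if Rle_dec 0 x then sP (s x) else sR (s (- x))).
assert (hAp : forall x, 0 <= x -> A x = sU (s x)).
{ intros x hx. unfold A. now destruct (Rle_dec 0 x). }
assert (hQp : forall x, 0 <= x -> Q x = sP (s x)).
{ intros x hx. unfold Q. now destruct (Rle_dec 0 x). }
assert (hAn : forall x, x <= 0 -> A x = sV (s (- x))).
{ intros x hx. unfold A. destruct (Rle_dec 0 x); [|easy].
  replace x with 0 by lra. now rewrite Ropp_0. }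
assert (hQn : forall x, x <= 0 -> Q x = sR (s (- x))).
{ intros x hx. unfold Q. destruct (Rle_dec 0 x); [|easy].
  replace x with 0 by lra. now rewrite Ropp_0. }
assert (hA0 : forall x, 0 <= A x).
{ intro x. unfold A. destruct (Rle_dec 0 x); apply hs; lra. }
assert (hQ0 : forall x, 0 <= Q x).
{ intro x. unfold Q. destruct (Rle_dec 0 x); apply hs; lra. }
(* An interval containing 0 is cut there; the slope bounds of the two halves are then weakened to
   those of the whole interval. *)
assert (hglue : forall (f : R -> R) (G : R -> R -> R),
  (forall x y, 0 <= x <= y -> (y - x) * G x y <= f y - f x <= (y - x) * G y x) ->
  (forall x y, x <= y <= 0 -> (y - x) * G x y <= f y - f x <= (y - x) * G y x) ->
  (forall x y, x <= 0 <= y -> (G x y <= G x 0 /\ G x y <= G 0 y) /\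
                              (G 0 x <= G y x /\ G y 0 <= G y x)) ->
  forall x y, x <= y -> (y - x) * G x y <= f y - f x <= (y - x) * G y x).
{ intros f G hpos hneg hmono x y hxy.
  destruct (Rle_dec 0 x); [now apply hpos|].
  destruct (Rle_dec y 0); [now apply hneg|].
  destruct (hpos 0 y), (hneg x 0), (hmono x y) as [[] []]; try lra.
  rewrite Rminus_0_r in *.
  assert (y * G x y <= y * G 0 y) by (apply Rmult_le_compat_l; lra).
  assert (y * G y 0 <= y * G y x) by (apply Rmult_le_compat_l; lra).
  assert ((0 - x) * G x y <= (0 - x) * G x 0) by (apply Rmult_le_compat_l; lra).
  assert ((0 - x) * G 0 x <= (0 - x) * G y x) by (apply Rmult_le_compat_l; lra).
  lra. }
assert (hpow : forall c a, 0 <= c -> 0 <= c * pos_pow (/ (p - 1)) a).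
{ intros. apply Rmult_le_pos; [easy | apply pos_pow_ge0]. }
assert (hprod : forall c a b, 0 <= c ->
  0 <= c * (pos_pow p a * pos_pow (p - 1) b)).
{ intros. apply Rmult_le_pos; [easy|].
  apply Rmult_le_pos; apply pos_pow_ge0. }
assert (hAmono : forall x, (0 <= x -> A 0 <= A x) /\ (x <= 0 -> A x <= A 0)).
{ intro x. split; intro hx.
  - destruct (hinc 0 x) as [[h _] _]; [lra|].
    rewrite !hAp by lra. pose proof (hpow (x - 0) (sP (s 0))). lra.
  - destruct (hinc 0 (- x)) as [_ [_ [[h _] _]]]; [lra|].
    rewrite !hAn, Ropp_0 by lra.
    pose proof (hpow (- x - 0) (sR (s (- x)))). lra. }
assert (hQmono : forall x, (0 <= x -> Q 0 <= Q x) /\ (x <= 0 -> Q x <= Q 0)).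
{ intro x. split; intro hx.
  - destruct (hinc 0 x) as [_ [[h _] _]]; [lra|].
    rewrite !hQp by lra. pose proof (hprod (x - 0) (sV (s x)) (sU (s 0))). lra.
  - destruct (hinc 0 (- x)) as [_ [_ [_ [h _]]]]; [lra|].
    rewrite !hQn, Ropp_0 by lra.
    pose proof (hprod (- x - 0) (sU (s 0)) (sV (s (- x)))). lra. }
exists A, Q. split; [easy|]. split; [easy|].
split; [rewrite hAp, hQp; lra|]. split.
- apply (hglue A (fun x y => pos_pow (/ (p - 1)) (Q x))).
  + intros x y hxy. destruct (hinc x y hxy) as [h _].
    rewrite !hAp, !hQp by lra. exact h.
  + intros x y hxy. destruct (hinc (- y) (- x)) as [_ [_ [h _]]]; [lra|].
    rewrite !hAn, !hQn by lra.
    replace (- x - - y) with (y - x) in h by ring. exact h.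
  + intros x y hxy.
    destruct (hQmono x) as [_ h1], (hQmono y) as [h2 _].
    repeat split; apply pos_pow_le; lra.
- apply (hglue Q (fun x y => pos_pow p (A (- y)) * pos_pow (p - 1) (A x))).
  + intros x y hxy. destruct (hinc x y hxy) as [_ [h _]].
    rewrite !hQp, !(hAn (- _)), !Ropp_involutive, !hAp by lra. exact h.
  + intros x y hxy. destruct (hinc (- y) (- x)) as [_ [_ [_ h]]]; [lra|].
    rewrite !hQn, !(hAp (- _)), !hAn by lra.
    replace (- x - - y) with (y - x) in h by ring. exact h.
  + intros x y hxy.
    destruct (hAmono x) as [_ h1], (hAmono y) as [h2 _].
    destruct (hAmono (- x)) as [h3 _], (hAmono (- y)) as [_ h4].
    rewrite !Ropp_0.
    repeat split; apply Rmult_le_compat; try apply pos_pow_ge0;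
      apply pos_pow_le; lra.
Qed.

(* The critical exponent [p - 1] rules out a dead core: if [A] and [Q] vanish
   at [z], then [A y <= (y - z) * (C * (y - z))^(1/(p-1)) * A y], so they
   vanish on an interval whose length can be chosen uniformly in [z]. *)
Lemma line_profile_pos (p : R) (A Q : R -> R) (hp : 1 < p)
  (hA0 : forall x, 0 <= A x) (hQ0 : forall x, 0 <= Q x) (h01 : A 0 + Q 0 = 1)
  (hA : forall x y, x <= y ->
      (y - x) * pos_pow (/ (p - 1)) (Q x) <= A y - A x
      <= (y - x) * pos_pow (/ (p - 1)) (Q y))
  (hQ : forall x y, x <= y ->
      (y - x) * (pos_pow p (A (- y)) * pos_pow (p - 1) (A x)) <= Q y - Q x
      <= (y - x) * (pos_pow p (A (- x)) * pos_pow (p - 1) (A y))) (x : R) :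
  0 < A x.
Proof.
assert (hq : 0 < / (p - 1)) by (apply Rinv_0_lt_compat; lra).
assert (hAmono : forall a b, a <= b -> A a <= A b).
{ intros a b hab. destruct (hA a b hab) as [h _].
  pose proof (Rmult_le_pos (b - a) _ ltac:(lra) (pos_pow_ge0 (/ (p - 1)) (Q a))).
  lra. }
assert (hQmono : forall a b, a <= b -> Q a <= Q b).
{ intros a b hab. destruct (hQ a b hab) as [h _].
  pose proof (Rmult_le_pos (b - a) _ ltac:(lra)
    (Rmult_le_pos _ _ (pos_pow_ge0 p (A (- b))) (pos_pow_ge0 (p - 1) (A a)))).
  lra. }
apply Rnot_le_lt. intro hx.
(* If [A x = 0], the slope of [A] on the unit interval from [z0] to [x] forces [Q z0 = 0] as
   well. *)
set (z0 := x - 1).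
set (C := pos_pow p (A (- z0))).
assert (hC : 0 <= C) by apply pos_pow_ge0.
(* [C] bounds the factor [pos_pow p (A (- z))] for every [z >= z0]. The bound [delta * C <= 1] gives
   [Q y <= pos_pow (p - 1) (A y)], and [delta <= / 2] then gives [A y <= A y / 2]. *)
set (delta := Rmin (/ 2) (/ (C + 1))).
assert (hdelta : 0 < delta).
{ apply Rmin_glb_lt; [lra | apply Rinv_0_lt_compat; lra]. }
assert (hdelta2 : delta <= / 2) by apply Rmin_l.
assert (hdeltaC : delta * C <= 1).
{ apply Rle_trans with (/ (C + 1) * (C + 1)).
  - apply Rmult_le_compat; try lra. apply Rmin_r.
  - right. field. lra. }
assert (hvanish : forall n,
  A (z0 + INR n * delta) = 0 /\ Q (z0 + INR n * delta) = 0).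
{ induction n as [|n [IHA IHQ]].
  - simpl. rewrite Rmult_0_l, Rplus_0_r.
    pose proof (hA0 z0). pose proof (hQ0 z0). pose proof (hA0 x).
    assert (A z0 <= A x) by (apply hAmono; unfold z0; lra).
    destruct (hA z0 x) as [h _]; [unfold z0; lra|].
    split; [lra|].
    apply Rle_antisym; [|easy]. apply Rnot_lt_le. intro hlt.
    rewrite pos_pow_pos in h by easy.
    assert (0 < Rpower (Q z0) (/ (p - 1))) by apply exp_pos.
    replace (x - z0) with 1 in h by (unfold z0; ring). lra.
  - rewrite S_INR.
    set (z := z0 + INR n * delta) in *.
    replace (z0 + (INR n + 1) * delta) with (z + delta) by (unfold z; ring).
    assert (hz : z0 <= z).
    { pose proof (Rmult_le_pos _ _ (pos_INR n) (Rlt_le _ _ hdelta)).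
      unfold z. lra. }
    set (y := z + delta).
    destruct (hA z y) as [_ hAy]; [unfold y; lra|].
    destruct (hQ z y) as [_ hQy]; [unfold y; lra|].
    replace (y - z) with delta in * by (unfold y; ring).
    rewrite IHA in hAy. rewrite IHQ in hQy.
    assert (hQy' : Q y <= pos_pow (p - 1) (A y)).
    { apply Rle_trans with (delta * C * pos_pow (p - 1) (A y)).
      - assert (pos_pow p (A (- z)) <= C).
        { apply pos_pow_le; [lra|]. apply hAmono. lra. }
        assert (delta * (pos_pow p (A (- z)) * pos_pow (p - 1) (A y))
                <= delta * (C * pos_pow (p - 1) (A y))).
        { apply Rmult_le_compat_l; [lra|].
          apply Rmult_le_compat_r; [apply pos_pow_ge0 | easy]. }
        lra.
      - rewrite <- (Rmult_1_l (pos_pow (p - 1) (A y))) at 2.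
        apply Rmult_le_compat_r; [apply pos_pow_ge0 | easy]. }
    assert (hAy' : pos_pow (/ (p - 1)) (Q y) <= A y).
    { rewrite <- (pos_pow_K (/ (p - 1)) (p - 1) (A y)); [|field; lra|easy].
      now apply pos_pow_le. }
    assert (hAy0 : A y = 0).
    { apply Rle_antisym; [|easy].
      pose proof (Rmult_le_compat_l delta _ _ (Rlt_le _ _ hdelta) hAy').
      pose proof (Rmult_le_compat_r _ _ _ (hA0 y) hdelta2). lra. }
    split; [easy|].
    rewrite hAy0, (pos_pow_nonpos (p - 1)) in hQy' by lra.
    apply Rle_antisym; easy. }
(* Enough steps of the fixed length [delta] reach beyond 0, where monotonicity contradicts
   [A 0 + Q 0 = 1]. *)
destruct (nfloor_ex (Rabs z0 / delta)) as [n [_ hn]].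
{ apply Rmult_le_pos; [apply Rabs_pos | now apply Rlt_le, Rinv_0_lt_compat]. }
destruct (hvanish (S n)) as [hAn hQn].
assert (hge : 0 <= z0 + INR (S n) * delta).
{ rewrite S_INR.
  apply (Rmult_lt_compat_r delta) in hn; [|easy].
  unfold Rdiv in hn. rewrite Rmult_assoc, Rinv_l, Rmult_1_r in hn by lra.
  pose proof (Rle_abs (- z0)). rewrite Rabs_Ropp in *. lra. }
pose proof (hAmono _ _ hge). pose proof (hQmono _ _ hge). lra.
Qed.

(** * Inverting the flux and assembling the solution *)

Lemma p_flux_opp (p s : R) : p_flux p (- s) = - p_flux p s.
Proof. unfold p_flux. rewrite Rabs_Ropp. ring. Qed.

Lemma p_flux_pos_pow (p q : R) (hp : 1 < p) (hq : 0 <= q) :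
  p_flux p (pos_pow (/ (p - 1)) q) = q.
Proof.
unfold p_flux. rewrite Rabs_pos_eq by apply pos_pow_ge0.
destruct hq as [hq | hq].
- assert (hs : 0 < pos_pow (/ (p - 1)) q).
  { rewrite pos_pow_pos by easy. apply exp_pos. }
  (* The linear factor of the flux is written as a first power, so that the exponents [p - 2] and 1
     add up to [p - 1]. *)
  rewrite <- (Rpower_1 (pos_pow _ _)) at 2 by easy.
  rewrite <- Rpower_plus, <- pos_pow_pos by easy.
  apply pos_pow_K; [field|]; lra.
- rewrite pos_pow_nonpos; lra.
Qed.

Theorem theorem3p1 (p : R) (hp : 1 < p) :
  exists U V : R -> R,
    positive_entire_solution p U V /\ (forall x : R, U x = V (- x)).
Proof.
assert (hq : 0 < / (p - 1)) by (apply Rinv_0_lt_compat; lra).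
destruct (line_profile p hp) as [A [Q [hA0 [hQ0 [h01 [hA hQ]]]]]].
assert (hpos := line_profile_pos p A Q hp hA0 hQ0 h01 hA hQ).
set (psi := fun x => pos_pow (/ (p - 1)) (Q x)).
assert (hAmono : forall a b, a <= b -> A a <= A b).
{ intros a b hab. destruct (hA a b hab) as [h _].
  pose proof (Rmult_le_pos (b - a) _ ltac:(lra) (pos_pow_ge0 (/ (p - 1)) (Q a))).
  lra. }
assert (hprod : forall a b, 0 <= pos_pow p a * pos_pow (p - 1) b).
{ intros. apply Rmult_le_pos; apply pos_pow_ge0. }
(* Regularity is gained in turn: [Q] is continuous, so [A] has the continuous derivative [psi], so
   [A] is continuous, so [Q] is differentiable. *)
assert (hQc : forall x, continuous Q x).
{ intro x.
  apply (continuous_of_local_slopes Q x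
    (pos_pow p (A (- (x - 1))) * pos_pow (p - 1) (A (x + 1)))).
  intros a b ha hb. destruct (hQ a b) as [h1 h2]; [lra|].
  pose proof (Rmult_le_pos (b - a) _ ltac:(lra) (hprod (A (- b)) (A a))).
  split; [lra|]. apply Rle_trans with (1 := h2).
  apply Rmult_le_compat_l; [lra|].
  apply Rmult_le_compat; try apply pos_pow_ge0; apply pos_pow_le;
    try apply hAmono; lra. }
assert (hpsic : forall x, continuous psi x).
{ intro x. apply (continuous_comp Q (pos_pow (/ (p - 1)))); [apply hQc|].
  now apply pos_pow_continuous. }
assert (hdA : forall x, is_derive A x (psi x)).
{ intro x. apply (is_derive_of_two_sided_slopes A (fun a _ => psi a)).
  - exact hA.
  - apply continuous_const.
  - apply hpsic. }
assert (hAc : forall x, continuous A x).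
{ intro x. apply (ex_derive_continuous (K := R_AbsRing) (V := R_NormedModule)).
  now exists (psi x). }
assert (hopp : forall (f : R -> R), (forall x, continuous f x) ->
  forall x, continuous (fun y => f (- y)) x).
{ intros f hf x. apply (continuous_comp Ropp f); [|apply hf].
  apply (continuous_opp (fun y : R => y)), continuous_id. }
assert (hpowc : forall a (f : R -> R), 0 < a -> (forall x, continuous f x) ->
  forall x, continuous (fun y => pos_pow a (f y)) x).
{ intros a f ha hf x. apply (continuous_comp f (pos_pow a)); [apply hf|].
  now apply pos_pow_continuous. }
assert (hdQ : forall x,
  is_derive Q x (pos_pow p (A (- x)) * pos_pow (p - 1) (A x))).
{ intro x.
  apply (is_derive_of_two_sided_slopes Q
    (fun a b => pos_pow p (A (- b)) * pos_pow (p - 1) (A a))).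
  - exact hQ.
  - apply (continuous_mult (fun y => pos_pow p (A (- y)))).
    + apply (hpowc p (fun y => A (- y))); [lra|]. now apply hopp.
    + apply continuous_const.
  - apply (continuous_mult (fun y => pos_pow p (A (- x)))).
    + apply continuous_const.
    + apply hpowc; [lra | easy]. }
assert (hreflect : forall (f : R -> R) x l, is_derive f (- x) l ->
  is_derive (fun y => f (- y)) x (- l)).
{ intros f x l hf.
  replace (- l) with (scal (opp one) l) by
    (unfold scal, opp, one; simpl; unfold mult; simpl; ring).
  apply (is_derive_comp f Ropp); [easy|].
  apply (is_derive_opp (fun y : R => y)), is_derive_id. }
assert (hdV : forall x, is_derive (fun y => A (- y)) x (- psi (- x))).
{ intro x. apply hreflect, hdA. }
assert (hU' : forall x, Derive A x = psi x).
{ intro x. now apply is_derive_unique. }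
assert (hV' : forall x, Derive (fun y => A (- y)) x = - psi (- x)).
{ intro x. now apply is_derive_unique. }
exists A, (fun x => A (- x)). split.
- split; [|split; [|split; [|split; [|split]]]].
  + exact hpos.
  + intro x. apply hpos.
  + intro x. split; [now exists (psi x)|].
    now apply (continuous_ext psi).
  + intro x. split; [now exists (- psi (- x))|].
    apply (continuous_ext (fun y => - psi (- y))); [easy|].
    apply (continuous_opp (fun y => psi (- y))). now apply hopp.
  + intro x. apply is_derive_ext with Q.
    * intro y. rewrite hU'. symmetry. now apply p_flux_pos_pow.
    * rewrite <- !pos_pow_pos by apply hpos. apply hdQ.
  (* Reflection makes the flux of V' odd-reflected: it is [- Q (- y)], and its two signs cancel on
     differentiation, leaving the derivative of [Q] at [- x]. *)
  + intro x. apply is_derive_ext with (fun y => - Q (- y)).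
    * intro y. rewrite hV', p_flux_opp. f_equal. symmetry.
      now apply p_flux_pos_pow.
    * rewrite <- !pos_pow_pos by apply hpos.
      rewrite <- (Ropp_involutive (pos_pow p (A x) * _)).
      apply (is_derive_opp (fun y => Q (- y))), hreflect.
      rewrite <- (Ropp_involutive x) at 2. apply hdQ.
- intro x. now rewrite Ropp_involutive.
Qed.
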